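(* Let $N\ge 1$, let $K\in\mathbb{N}\cup\{\infty\}$, let $0<\epsilon,\delta<1$, let $B$ be a real symmetric $N\times N$ matrix all of whose eigenvalues lie strictly between $0$ and $1$, and let $a_I\in\mathbb{R}$ for $I\in\mathbb{N}^N$ with $|I|$ even and $|I|\le 2K$. Suppose all $a_I\ge 0$, $b_{\min}>0$, and $|\mu_{\mathrm{Haf}}|>\mu_0$ for some $\mu_0>0$. Suppose there exist real numbers $c_1,c_2,q_1,q_2,\gamma_1,\gamma_2$ such that for all $1\le k\le K$ ($k<\infty$) $$\sum_{|I|=2k}a_I\le c_1\frac{k^{q_1}\gamma_1^{k}}{k!}\qquad\text{and}\qquad \sum_{|I|=2k}a_I\,I!\le c_2\,k^{q_2}\gamma_2^{k}\,k!.$$ If $K=\infty$, suppose further that $\gamma_1<\frac1{2b_{\max}}$ and $\gamma_2<2b_{\min}$. Then $$n^{\mathrm{GBS\text{-}P}}_{\mathrm{Haf}}\le\frac1{d\,\delta\,\epsilon^2}\,\frac1{\mu_0}\left(a_0+c_2\sqrt\pi\,e^{\frac16-\frac1{25}}\,\mathrm{Li}_{-\frac12-q_2,K}\!\left(\frac{\gamma_2}{2b_{\min}}\right)\right)-\frac1{\delta\epsilon^2}.$$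
   Context: $\mathbb{N}=\{0,1,2,\dots\}$. For $I=(i_1,\dots,i_N)\in\mathbb{N}^N$: $|I|=i_1+\cdots+i_N$, $I!=i_1!\cdots i_N!$; $a_0$ denotes the coefficient $a_{(0,\dots,0)}$. Hafnian: for a $2m\times 2m$ matrix $M$, $m\ge 1$, $\mathrm{Haf}(M)=\frac{1}{m!2^m}\sum_{\sigma\in S_{2m}}\prod_{j=1}^m M_{\sigma(2j-1),\sigma(2j)}$; the hafnian of the empty matrix is $1$. For an $N\times N$ matrix $B$ and $I\in\mathbb{N}^N$, $B_I$ is the $|I|\times|I|$ matrix obtained from $B$ by repeating the $n$-th row and the $n$-th column $i_n$ times each (deleting them if $i_n=0$). $b_{\max}$ is the maximum of the absolute values of the entries of $B$ and $b_{\min}$ is the minimum of the entries of $B$. $d=\prod_{j=1}^N\sqrt{1-\lambda_j^2}$, where $\lambda_1,\dots,\lambda_N$ are the eigenvalues of $B$. Quantities (all sums over $k$ run over finite $k$ with $0\le k\le K$): $$\mu_{\mathrm{Haf}}=\sum_{k=0}^K\sum_{|I|=2k}a_I\,\mathrm{Haf}(B_I),\qquad Q=\frac{\mu_{\mathrm{Haf}}}d\sum_{k=0}^K\sum_{|J|=2k}\frac{a_J\,J!}{\mathrm{Haf}(B_J)},\qquad n^{\mathrm{GBS\text{-}P}}_{\mathrm{Haf}}=\frac{Q-\mu_{\mathrm{Haf}}^2}{\delta\epsilon^2\mu_{\mathrm{Haf}}^2}.$$ ($\mu_{\mathrm{Haf}}$ is the expectation of $\sum_I a_I x^I$ for $x\sim\mathcal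 N(0,B)$; $n^{\mathrm{GBS\text{-}P}}_{\mathrm{Haf}}$ is the guaranteed sample size of the probability estimator.) Truncated polylogarithm: $\mathrm{Li}_{s,K}(z)=\sum_{k=1}^K \frac{z^k}{k^s}$ (with $\mathrm{Li}_{s,0}(z)=0$, defined for all real $z$ if $K<\infty$, and for $|z|<1$ if $K=\infty$). *)

(* Defs.v *)
From HB Require Import structures.
From mathcomp Require Import all_boot all_order all_algebra all_fingroup.
From mathcomp Require Import all_classical all_reals all_analysis.

Set Implicit Arguments.
Unset Strict Implicit.
Unset Printing Implicit Defensive.

Import Order.TTheory GRing.Theory Num.Theory.
Import numFieldNormedType.Exports.

Local Open Scope classical_set_scope.
Local Open Scope ring_scope.

Notation multiindex N := {ffun 'I_N -> nat}.

Definition mdeg (N : nat) (I : multiindex N) : nat := (\sum_(i < N) I i)%N.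
Definition mfact (N : nat) (I : multiindex N) : nat := (\prod_(i < N) (I i)`!)%N.
Definition multiindex0 (N : nat) : multiindex N := [ffun=> 0%N].

Definition sum_deg (R : realType) (N k : nat) (F : multiindex N -> R) : R :=
  \sum_(I \in [set I : multiindex N | mdeg I = k]) F I.

Section Hafnian.
Variables (R : realType).

Lemma pair_fst_subproof n (j : 'I_n./2) : (j.*2 < n)%N.
Proof. by apply: ltnW; rewrite -gtn_half_double ltn_ord. Qed.

Lemma pair_snd_subproof n (j : 'I_n./2) : (j.*2.+1 < n)%N.
Proof. by rewrite -gtn_half_double ltn_ord. Qed.

(* The j-th pair (2j, 2j+1): with 0-based indices this is (2j-1, 2j) for
   j = 1, ..., m. *)
Definition pair_fst n (j : 'I_n./2) : 'I_n := Ordinal (pair_fst_subproof j).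
Definition pair_snd n (j : 'I_n./2) : 'I_n := Ordinal (pair_snd_subproof j).

(* Meaningful for even n = 2m only, with m = n./2.  The size is left general so
   that the |I| x |I| matrix B_I needs no cast. *)
Definition haf n (M : 'M[R]_n) : R :=
  ((n./2)`!%:R * 2 ^+ n./2)^-1 *
  \sum_(s : 'S_n) \prod_(j < n./2) M (s (pair_fst j)) (s (pair_snd j)).

(* B_I: the (i, j) entry of B becomes a constant block of size I i x I j. *)
Definition repmx N (B : 'M[R]_N) (I : multiindex N) : 'M[R]_(mdeg I) :=
  \mxblock_(i < N, j < N) (const_mx (B i j) : 'M[R]_(I i, I j)).

End Hafnian.

(* An element of N u {oo} is an option nat, None standing for oo. *)
Definition within_bound (k : nat) (K : option nat) : bool :=
  if K is Some K' then (k <= K')%N else true.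

(* The sum of u k over the finite k with m <= k <= K; for K = oo, the limit of
   the partial sums. *)
Definition sum_upto (R : realType) (m : nat) (K : option nat) (u : nat -> R) : R :=
  if K is Some K' then \sum_(m <= k < K'.+1) u k
  else limn (fun n => \sum_(m <= k < n) u k).

Definition polylog (R : realType) (s : R) (K : option nat) (z : R) : R :=
  sum_upto 1 K (fun k => z ^+ k / k%:R `^ s).

Section Quantities.
Variables (R : realType) (N : nat).
Implicit Types (B : 'M[R]_N) (lam : 'I_N -> R) (a : multiindex N -> R).

Definition bmax B : R := \big[Num.max/0]_(i < N) \big[Num.max/0]_(j < N) `|B i j|.

(* For N >= 1 the initial value bmax B is at least every entry, hence harmless. *)
Definition bmin B : R :=
  \big[Num.min/bmax B]_(i < N) \big[Num.min/bmax B]_(j < N) B i j.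

(* lam lists the eigenvalues of B with multiplicity. *)
Definition is_spectrum B lam : Prop :=
  char_poly B = \prod_(j < N) ('X - (lam j)%:P).

Definition dfactor lam : R := \prod_(j < N) Num.sqrt (1 - lam j ^+ 2).

Definition mu_haf (K : option nat) B a : R :=
  sum_upto 0 K (fun k => sum_deg k.*2 (fun I => a I * haf (repmx B I))).

Definition Q_haf (K : option nat) B lam a : R :=
  mu_haf K B a / dfactor lam *
  sum_upto 0 K
    (fun k => sum_deg k.*2 (fun J => a J * (mfact J)%:R / haf (repmx B J))).

Definition n_gbsp (K : option nat) B lam a (delta eps : R) : R :=
  (Q_haf K B lam a - mu_haf K B a ^+ 2) /
  (delta * eps ^+ 2 * mu_haf K B a ^+ 2).

End Quantities.

(* Main.v *)
(* All entries of B_J are at least b_min, so Haf(B_J) >= (2k)!/(k! 2^k) b_min^k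
   when |J| = 2k.  The J-sum of order k in Q is therefore at most
   c2 k^q2 (gamma2/(2 b_min))^k * 4^k (k!)^2/(2k)!, where the last factor is at
   most 2 sqrt k <= sqrt(pi k) exp(1/6 - 1/25).  Summing over k bounds the
   second sum in Q, and mu > mu0 gives the claim. *)
Require Import Defs.
From mathcomp Require Import all_boot all_order all_algebra all_fingroup.
From mathcomp Require Import all_classical all_reals all_analysis.
From mathcomp Require Import ring lra zify.

Import Order.TTheory GRing.Theory Num.Theory.
Import numFieldNormedType.Exports.
Local Open Scope ring_scope.

(** * Numerical lower bound for the constant *)

Lemma sin_le_id (R : realType) (x : R) : 0 <= x -> sin x <= x.
Proof.
move=> x0.
have [c _] := @MVT_segment R sin cos 0 x x0
  (fun y _ => is_derive_sin y) (continuous_subspaceT (@continuous_sin R)).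
rewrite sin0 !subr0 => ->.
by rewrite ler_piMl// cos_le1.
Qed.

(* 16 sin (pi / 16) <= pi, with sin (pi / 16) computed by angle halving. *)
Lemma pi_lower_bound (R : realType) : 240 / 77 <= pi :> R.
Proof.
have p0 := pi_gt0 R.
have cs (n : R) : 2 < n -> 0 < cos (pi / n).
  move=> n2; apply: cos_gt0_pihalf; have n0 : 0 < n by lra.
  rewrite (lt_trans (y := 0)) ?divr_gt0 ?oppr_lt0 ?divr_gt0//=.
  by rewrite ltr_pM2l// ltf_pV2// posrE.
have E (x : R) : pi / x = pi / (2 * x) *+ 2.
  by rewrite -mulr_natr invfM; move: (x^-1) => y; field.
have h2 : cos (pi / 4) ^+ 2 *+ 2 = 1 :> R.
  by have := cos_pihalf R; rewrite (E 2) cos_mulr2n -natrM => /eqP; rewrite subr_eq0 => /eqP.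
have h3 : cos (pi / 8) ^+ 2 *+ 2 - 1 = cos (pi / 4) :> R.
  by rewrite (E 4) cos_mulr2n -natrM.
have h4 : 1 - sin (pi / 16) ^+ 2 *+ 2 = cos (pi / 8) :> R.
  by rewrite (E 8) cos_mulr2n -natrM cos2sin2; ring.
have h5 : sin (pi / 16) <= pi / 16 :> R by apply: sin_le_id; lra.
have h6 : 0 <= sin (pi / 16) :> R by apply: sin_ge0_pi; lra.
have := cs 4 ltac:(lra); have := cs 8 ltac:(lra).
move: h2 h3 h4 h5 h6.
move: (cos _) (cos _) (sin _) => c3 c2 s h2 h3 h4 h5 h6 c3p c2p.
rewrite !mulr2n in h2 h3 h4.
(* Rounding outward at each halving: 29/41 is just above cos(pi/4) and 73/79 just above cos(pi/8),
   so 15/77 lies just below sin(pi/16), and 16 * 15/77 = 240/77. *)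
have b2 : c2 <= 29 / 41 by rewrite -ler_sqr ?nnegrE; lra.
have b3 : c3 <= 73 / 79 by rewrite -ler_sqr ?nnegrE; lra.
have b4 : 15 / 77 <= s by rewrite -ler_sqr ?nnegrE; lra.
lra.
Qed.

(** The two factors are bounded below by 30/17 and 17/15, whose product is 2; (30/17)^2 lies just
    below 240/77. *)
Lemma two_le_stirling_const (R : realType) :
  2 <= Num.sqrt pi * expR (1 / 6 - 1 / 25) :> R.
Proof.
have e : 17 / 15 <= expR (1 / 6 - 1 / 25) :> R.
  (* Splitting the exponent into 8 equal parts makes [1 + x <= expR x] sharp enough; three
     squarings, each rounded down, restore it. *)
  have -> : 1 / 6 - 1 / 25 = 8%:R * (19 / 1200) :> R by field.
  rewrite expRM_natl (exprM _ 2 4) (exprM _ 2 2).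
  have := expR_ge1Dx (19 / 1200 : R); set y := expR _ => y1.
  have {}y1 : 193 / 190 <= y by lra.
  have sq (a b c : R) : 0 <= b -> b <= a -> c <= b * b -> c <= a ^+ 2.
    by move=> b0 ba /le_trans; apply; rewrite expr2 ler_pM.
  have {}y1 : 227 / 220 <= y ^+ 2 by apply: (sq _ _ _ _ y1); lra.
  have {}y1 : 280 / 263 <= y ^+ 2 ^+ 2 by apply: (sq _ _ _ _ y1); lra.
  by apply: (sq _ _ _ _ y1); lra.
have s : 30 / 17 <= Num.sqrt pi :> R.
  have n : 0 <= 30 / 17 :> R by lra.
  rewrite -ler_sqr ?nnegrE ?sqrtr_ge0// sqr_sqrtr ?pi_ge0//.
  by apply: le_trans (pi_lower_bound R); lra.
by apply: le_trans (ler_pM _ _ s e); lra.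
Qed.

(** * Central binomial coefficients and the hafnian from below *)

(** This is 4^k / binomial(2k, k) <= 2 sqrt k, squared so that it stays in [nat]. The induction step
    comes down to 4m(m+1) <= (2m+1)^2. *)
Lemma central_bin_bound (k : nat) : (0 < k)%N ->
  (16 ^ k * k`! ^ 4 <= 4 * k * (k.*2)`! ^ 2)%N.
Proof.
elim: k => // -[|k] IH _ //.
have {}IH := IH isT.
rewrite expnS factS doubleS !factS.
set m := k.+1 in IH *.
have -> : (16 * 16 ^ m * (m.+1 * m`!) ^ 4 = (16 * m.+1 ^ 4) * (16 ^ m * m`! ^ 4))%N by ring.
have -> : (4 * m.+1 * (m.*2.+2 * (m.*2.+1 * (m.*2)`!)) ^ 2 =
  (4 * m.+1 * (m.*2.+2 * m.*2.+1) ^2) * (m.*2)`! ^ 2)%N by ring.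
have : (16 * m.+1 ^ 4 * (4 * m) <= 4 * m.+1 * (m.*2.+2 * m.*2.+1) ^ 2)%N.
  have -> : (16 * m.+1 ^ 4 * (4 * m) = 16 * m.+1 ^ 3 * (4 * m * m.+1))%N by ring.
  have -> : (4 * m.+1 * (m.*2.+2 * m.*2.+1) ^ 2 = 16 * m.+1 ^ 3 * m.*2.+1 ^ 2)%N.
    by rewrite -doubleS -!muln2; ring.
  by rewrite leq_mul2l; apply/orP; right; nia.
move=> h; apply: leq_trans (leq_mul h (leqnn _)).
by rewrite -(mulnA _ (4 * m)%N) leq_mul2l IH orbT.
Qed.

(** Each of the n! products in the hafnian is at least b^(n/2). *)
Lemma haf_ge (R : realType) (n : nat) (M : 'M[R]_n) (b : R) :
  0 <= b -> (forall i j, b <= M i j) ->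
  n`!%:R * b ^+ n./2 / ((n./2)`!%:R * 2 ^+ n./2) <= haf M.
Proof.
move=> b0 bM; rewrite /haf mulrC ler_pM2l; last first.
  by rewrite invr_gt0 mulr_gt0 ?exprn_gt0// ltr0n fact_gt0.
rewrite -(card_Sn n) mulr_natl -sumr_const; apply: ler_sum => s _.
rewrite -[X in _ ^+ X]card_ord -prodr_const.
by apply: ler_prod => i _; rewrite b0 bM.
Qed.

Lemma bmin_le (R : realType) (N : nat) (B : 'M[R]_N) i j : bmin B <= B i j.
Proof. by apply: (bigmin_inf i) => //; apply: (bigmin_inf j). Qed.

(** * Sums over multi-indices of fixed degree *)

(** Every coordinate is at most d, so the maps into ['I_d.+1] cover the set. Finiteness turns
    [sum_deg] into an ordinary finite sum. *)
Lemma finite_set_mdeg (N d : nat) : finite_set [set I : multiindex N | mdeg I = d]%classic.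
Proof.
pose f (g : {ffun 'I_N -> 'I_d.+1}) : multiindex N := [ffun i => nat_of_ord (g i)].
apply: (@sub_finite_set _ _ (f @` setT)%classic); last exact/finite_image/finite_finset.
move=> I /= Id; exists [ffun i => inord (I i)] => //.
apply/ffunP => i; rewrite !ffunE inordK// ltnS -Id /mdeg (bigD1 i)//=.
exact: leq_addr.
Qed.

Lemma ler_sum_deg (R : realType) (N d : nat) (F G : multiindex N -> R) :
  (forall I, mdeg I = d -> F I <= G I) -> sum_deg d F <= sum_deg d G.
Proof.
move=> FG; rewrite /sum_deg !fsbig_finite; try exact: finite_set_mdeg.
rewrite big_seq [leRHS]big_seq; apply: ler_sum => I.
by rewrite in_fset_set; [rewrite inE => /FG | exact: finite_set_mdeg].
Qed.

(** * Convergence and comparison of sums up to [K] *)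

Lemma cvg_series_powR_geometric (R : realType) (s z : R) : 0 <= z < 1 ->
  cvgn (series (fun k => k%:R `^ s * z ^+ k)).
Proof.
move=> /andP[z0 z1].
(* The midpoint of z and 1 is positive even for z = 0, so its logarithm is usable; half of the decay
   is set aside to absorb k^s. *)
pose t := - ln ((1 + z) / 2) / 2.
have zz1 : 0 < (1 + z) / 2 < 1 by lra.
have t0 : 0 < t by rewrite divr_gt0// oppr_gt0 ln_lt0.
have zE : (1 + z) / 2 = expR (- t) * expR (- t).
  rewrite -expRD -[LHS]lnK ?posrE; last lra.
  by congr expR; rewrite /t; field.
(* The quotient comes from (kt)^(m+1) / (m+1)! <= e^(kt); the added 1 covers k = 0, where 0^0 = 1 if
   s = 0. *)
pose m := Num.truncn s; pose M := 1 + m.+1`!%:R / t ^+ m.+1.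
have Mf : 0 <= m.+1`!%:R / t ^+ m.+1 :> R by rewrite divr_ge0 ?exprn_ge0 ?ltW.
(* With (1 + z)/2 = e^(-2t), k^s z^k <= k^(m+1) e^(-2kt) <= M e^(-kt). *)
apply: (@series_le_cvg _ _ (geometric M (expR (- t)))) => [k|k|k|].
- by rewrite mulr_ge0 ?powR_ge0 ?exprn_ge0.
- by rewrite /= mulr_ge0 ?exprn_ge0 ?expR_ge0// addr_ge0.
- have zk : z ^+ k <= expR (- t) ^+ k * expR (- t) ^+ k.
    rewrite -exprMn -zE lerXn2r ?nnegrE; lra.
  apply: le_trans (ler_wpM2l (powR_ge0 _ _) zk) _.
  rewrite mulrA /= ler_wpM2r ?exprn_ge0 ?expR_ge0//.
  case: k {zk} => [|k].
    rewrite expr0 mulr1; have := powR_ge0 0 s.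
    have [->|s0] := eqVneq s 0; first by rewrite powRr0 /M; lra.
    by rewrite powR0// /M; lra.
  have ks : k.+1%:R `^ s <= k.+1%:R ^+ m.+1.
    by rewrite -powR_mulrn// ler_powR ?ler1n// ltW// truncnS_gt.
  apply: le_trans (ler_wpM2r _ ks) _; first by rewrite exprn_ge0 ?expR_ge0.
  rewrite -expRM_natl mulrN expRN ler_pdivrMr ?expR_gt0//.
  have kt : 0 <= k.+1%:R * t by rewrite mulr_ge0 ?ltW.
  have := expR_ge1Dxn m kt; rewrite exprMn => h.
  have -> : k.+1%:R ^+ m.+1 =
      m.+1`!%:R / t ^+ m.+1 * (k.+1%:R ^+ m.+1 * t ^+ m.+1 / m.+1`!%:R).
    field; rewrite pnatr_eq0 -lt0n fact_gt0 /=; exact/expf_neq0/lt0r_neq0.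
  apply: ler_pM => //; first by rewrite divr_ge0 ?mulr_ge0 ?exprn_ge0 ?ltW.
    by rewrite lerDr.
  by apply: le_trans h; rewrite lerDr.
- by apply: is_cvg_geometric_series; rewrite ger0_norm ?expR_ge0// expR_lt1 oppr_lt0.
Qed.

Lemma sum_upto_ge0 (R : realType) (m : nat) (K : option nat) (u : nat -> R) :
  (forall k, within_bound k K -> 0 <= u k) -> 0 <= sum_upto m K u.
Proof.
case: K => [K|] u0 /=; first by rewrite big_nat; apply: sumr_ge0 => k /andP[_ /u0].
(* A divergent sequence has [point = 0] as its [limn]. *)
have [cv|/dvgP ->//] := pselect (cvgn (fun n => \sum_(m <= k < n) u k)).
by apply: limr_ge => //; apply: nearW => n; apply: sumr_ge0 => k _; exact: u0.
Qed.

(** For [K = None], nonnegativity lets u inherit convergence from its majorant v. *)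
Lemma ler_sum_upto (R : realType) (K : option nat) (u v : nat -> R) :
  (forall k, within_bound k K -> 0 <= u k <= v k) ->
  (K = None -> cvgn (series v)) ->
  sum_upto 0 K u <= sum_upto 0 K v.
Proof.
case: K => [K|] uv cv /=.
  by rewrite !big_nat; apply: ler_sum => k /andP[_ /uv /andP[]].
have cu : cvgn (series u).
  apply: series_le_cvg (cv erefl) => k; have /andP[u0 le_uv] := uv k isT => //.
  exact: le_trans le_uv.
apply: (ler_lim cu (cv erefl)); apply: nearW => n.
by apply: ler_sum => k _; have /andP[] := uv k isT.
Qed.

(** Joins the order-0 term to a sum that starts at 1, as [polylog] does. For c = 0 the partial sums
    of v are eventually constant, so the identity holds whatever value [limn] gives to a divergent
    u. *)
Lemma sum_upto_affine (R : realType) (K : option nat) (u : nat -> R) (a c : R) :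
  (K = None -> c = 0 \/ cvgn (series u)) ->
  let v := fun k => if k is 0 then a else c * u k in
  (K = None -> cvgn (series v)) /\
  sum_upto 0 K v = a + c * sum_upto 1 K u.
Proof.
move=> cu v.
have vE n : \sum_(0 <= k < n.+1) v k = a + c * \sum_(1 <= k < n.+1) u k.
  rewrite big_ltn// mulr_sumr; congr (_ + _).
  by apply: eq_big_nat => -[].
case: K cu => [K|] cu; first by split => //; rewrite /= vE.
suff cv : (series v @ \oo --> a + c * sum_upto 1 None u)%classic.
  by split; [move=> _; apply: cvgP cv | exact/cvg_lim].
rewrite -cvg_shiftS.
have -> : (fun n => series v n.+1) = (fun n => a + c * \sum_(1 <= k < n.+1) u k).
  by apply/funext => n; rewrite /series /= vE.
have [->|{}cu] := cu erefl.
  by rewrite mul0r; under eq_fun do rewrite mul0r; exact: cvg_cst.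
apply: cvgD; first exact: cvg_cst.
apply: cvgM; first exact: cvg_cst.
rewrite (cvg_shiftS (fun n => \sum_(1 <= k < n) u k)).
(* Dropping the term of index 0 shifts the limit by [u 0]. *)
suff : ((fun n => \sum_(1 <= k < n) u k) @ \oo --> limn (series u) - u 0)%classic by move/cvgP.
rewrite -cvg_shiftS.
have -> : (fun n => \sum_(1 <= k < n.+1) u k) = (fun n => series u n.+1 - u 0).
  by apply/funext => n; rewrite /series /= [in RHS]big_ltn// addrC addKr.
apply: cvgB; last exact: cvg_cst.
by rewrite (cvg_shiftS (series u)).
Qed.

(** * Bounds for the single orders of the second sum in Q *)

Lemma sqrt_central_bin (R : realType) (k : nat) : (0 < k)%N ->
  4 ^+ k * k`!%:R ^+ 2 <= 2 * Num.sqrt k%:R * (k.*2)`!%:R :> R.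
Proof.
move=> /central_bin_bound h.
rewrite -ler_sqr ?nnegrE ?mulr_ge0 ?exprn_ge0 ?sqrtr_ge0//.
rewrite !exprMn sqr_sqrtr// -!exprM -natrX.
rewrite -!natrX -!natrM ler_nat.
by rewrite -expnD (mulnC k 2) [(4 ^ _)%N]expnM.
Qed.

Lemma dfactor_gt0 (R : realType) (N : nat) (lam : 'I_N -> R) :
  (forall j, 0 < lam j < 1) -> 0 < dfactor lam.
Proof.
move=> h; apply: prodr_gt0 => j _; rewrite sqrtr_gt0 subr_gt0.
by have /andP[l0 l1] := h j; rewrite expr_lt1 ?ltW.
Qed.

Lemma sum_deg0 (R : realType) (N : nat) (F : multiindex N -> R) :
  sum_deg 0 F = F (multiindex0 N).
Proof.
rewrite /sum_deg (_ : [set I | _]%classic = [set multiindex0 N]%classic) ?fsbig_set1//.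
apply/seteqP; split => I /=; rewrite /mdeg.
  move=> /eqP; rewrite sum_nat_eq0 => /forallP I0.
  by apply/ffunP => i; rewrite ffunE; exact/eqP/(implyP (I0 i)).
by move=> ->; rewrite big1 // => i _; rewrite ffunE.
Qed.

(** The size is a variable with an equation because [mdeg (multiindex0 N)] is only provably 0; this
    avoids a cast of the matrix. *)
Lemma haf_dim0 (R : realType) (n : nat) (M : 'M[R]_n) : n = 0%N -> haf M = 1.
Proof.
move=> n0; subst n.
rewrite /haf /= expr0 mulr1 fact0 invr1 mul1r.
under eq_bigr do rewrite big_ord0.
by rewrite sumr_const card_Sn.
Qed.

(** Repeating rows and columns creates no new entries, so all entries of B_I are still at least
    b_min. *)
Lemma haf_repmx_ge (R : realType) (N k : nat) (B : 'M[R]_N) (I : multiindex N) :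
  0 < bmin B -> mdeg I = k.*2 ->
  (k.*2)`!%:R * bmin B ^+ k / (k`!%:R * 2 ^+ k) <= haf (repmx B I).
Proof.
move=> b0 Ik.
have kE : k = (mdeg I)./2 by rewrite Ik doubleK.
rewrite -Ik kE; apply: haf_ge => [|i j]; first exact: ltW.
by rewrite !mxE bmin_le.
Qed.

(** Each 1/Haf(B_J) is replaced by 1/h, after which the bound on the numerators applies. A stands
    for c2 k^q2 gamma2^k. *)
Lemma sum_deg_div_haf_le (R : realType) (N k : nat) (B : 'M[R]_N)
    (a : multiindex N -> R) (A : R) :
  (0 < k)%N -> 0 < bmin B -> (forall I, mdeg I = k.*2 -> 0 <= a I) -> 0 <= A ->
  sum_deg k.*2 (fun I => a I * (mfact I)%:R) <= A * k`!%:R ->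
  0 <= sum_deg k.*2 (fun J => a J * (mfact J)%:R / haf (repmx B J))
    <= A * (2 * Num.sqrt k%:R) / (2 * bmin B) ^+ k.
Proof.
move=> k0 b0 a0 A0 sA.
pose h := (k.*2)`!%:R * bmin B ^+ k / (k`!%:R * 2 ^+ k).
have fp n : 0 < n`!%:R :> R by rewrite ltr0n fact_gt0.
have h0 : 0 < h by rewrite divr_gt0 ?mulr_gt0 ?exprn_gt0.
have hafh J : mdeg J = k.*2 -> h <= haf (repmx B J) by move=> ?; exact: haf_repmx_ge.
apply/andP; split.
  apply: fsumr_ge0 => J Jk; apply: mulr_ge0; first by rewrite mulr_ge0 ?a0.
  by rewrite invr_ge0 (le_trans (ltW h0)) ?hafh.
apply: (@le_trans _ _ (sum_deg k.*2 (fun J => a J * (mfact J)%:R * h^-1))).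
  apply: ler_sum_deg => J Jk; rewrite ler_wpM2l ?mulr_ge0 ?a0//.
  by rewrite lef_pV2 ?posrE ?hafh// (lt_le_trans h0) ?hafh.
rewrite -[leLHS]mulr_fsuml ler_pdivrMr//; apply: le_trans sA _.
rewrite -!mulrA ler_wpM2l//.
(* The powers of b_min cancel and 2^k 2^k = 4^k, which leaves [sqrt_central_bin]. *)
have -> : 2 * (Num.sqrt k%:R * (((2 * bmin B) ^+ k)^-1 * h)) =
    2 * Num.sqrt k%:R * (k.*2)`!%:R / (4 ^+ k * k`!%:R) :> R.
  have -> : 4 = 2 * 2 :> R by ring.
  rewrite /h !exprMn; field.
  by rewrite !gt_eqF ?exprn_gt0.
rewrite ler_pdivlMr ?mulr_gt0 ?exprn_gt0//.
by rewrite mulrCA -expr2 sqrt_central_bin.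
Qed.

Lemma cvg_polylog (R : realType) (s z : R) : 0 <= z < 1 ->
  cvgn (series (fun k => z ^+ k / k%:R `^ s)).
Proof.
move=> /(cvg_series_powR_geometric _ (- s)).
by under eq_fun do rewrite powRN mulrC.
Qed.

(** * Summation over the orders and passage to the sample size *)

Theorem theorem1p2 (R : realType) (N : nat) (K : option nat) (eps delta : R)
  (B : 'M[R]_N) (lam : 'I_N -> R) (a : multiindex N -> R)
  (mu0 c1 c2 q1 q2 gamma1 gamma2 : R) :
  (1 <= N)%N ->
  0 < eps < 1 ->
  0 < delta < 1 ->
  B^T = B ->
  is_spectrum B lam ->
  (forall j : 'I_N, 0 < lam j < 1) ->
  (forall (k : nat) (I : multiindex N),
     within_bound k K -> mdeg I = k.*2 -> 0 <= a I) ->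
  0 < bmin B ->
  0 < mu0 ->
  mu0 < `|mu_haf K B a| ->
  (forall k : nat, (1 <= k)%N -> within_bound k K ->
     sum_deg k.*2 a <= c1 * (k%:R `^ q1 * gamma1 ^+ k / k`!%:R)) ->
  (forall k : nat, (1 <= k)%N -> within_bound k K ->
     sum_deg k.*2 (fun I => a I * (mfact I)%:R)
       <= c2 * k%:R `^ q2 * gamma2 ^+ k * k`!%:R) ->
  (K = None -> gamma1 < 1 / (2 * bmax B) /\ gamma2 < 2 * bmin B) ->
  n_gbsp K B lam a delta eps
    <= 1 / (dfactor lam * delta * eps ^+ 2) * (1 / mu0) *
         (a (multiindex0 N)
          + c2 * Num.sqrt pi * expR (1 / 6 - 1 / 25)
            * polylog (- (1 / 2) - q2) K (gamma2 / (2 * bmin B)))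
       - 1 / (delta * eps ^+ 2).
Proof.
move=> N0 /andP[eps0 _] /andP[delta0 _] _ _ lam01 a0 b0 mu00 mu0mu _ ac2 KN.
have d0 := dfactor_gt0 _ _ _ lam01.
set mu := mu_haf K B a in mu0mu *.
have within0 : within_bound 0 K by case: (K).
have haf_ge0 k I : mdeg I = k.*2 -> 0 <= haf (repmx B I).
  move=> /(haf_repmx_ge _ _ _ B _ b0); apply: le_trans.
  by rewrite divr_ge0 ?mulr_ge0 ?exprn_ge0 ?ltW.
have mu_ge0 : 0 <= mu.
  apply: sum_upto_ge0 => k kK; apply: fsumr_ge0 => I /= Ik.
  by rewrite mulr_ge0 ?(a0 k) ?(haf_ge0 k).
rewrite ger0_norm// in mu0mu.
pose C : R := Num.sqrt pi * expR (1 / 6 - 1 / 25).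
have C2 : 2 <= C := two_le_stirling_const R.
pose z := gamma2 / (2 * bmin B).
pose u k : R := z ^+ k / k%:R `^ (- (1 / 2) - q2).
have bb : 0 < 2 * bmin B by rewrite mulr_gt0.
(* The signs of c2 and gamma2 are free, but k! times this product dominates a sum of nonnegative
   terms. *)
have A0 k : (0 < k)%N -> within_bound k K -> 0 <= c2 * k%:R `^ q2 * gamma2 ^+ k.
  move=> k0 kK.
  have : 0 <= sum_deg k.*2 (fun I => a I * (mfact I)%:R).
    by apply: fsumr_ge0 => I /= Ik; rewrite mulr_ge0 ?(a0 k).
  move=> /le_trans /(_ (ac2 k k0 kK)).
  by rewrite pmulr_lge0// ltr0n fact_gt0.
have cu : K = None -> c2 * C = 0 \/ cvgn (series u).
  move=> KE; have [_ g2] := KN KE.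
  have [g0|g0] := leP 0 gamma2.
    by right; apply: cvg_polylog; rewrite divr_ge0 ?(ltW bb)//= ltr_pdivrMr// mul1r.
  (* For gamma2 < 0, k = 1 and k = 2 in [A0] force opposite signs of c2. *)
  left; have := A0 1 isT; have := A0 2 isT; rewrite KE powR1 mulr1 expr1.
  move=> /(_ isT) A2 /(_ isT) A1.
  suff -> : c2 = 0 by rewrite mul0r.
  apply/eqP; rewrite eq_le; apply/andP; split; first by rewrite -(nmulr_lge0 _ g0).
  by move: A2; rewrite -mulrA pmulr_lge0// mulr_gt0 ?powR_gt0// exprn_even_gt0//= lt_eqF.
have [cv vE] := sum_upto_affine _ K u (a (multiindex0 N)) (c2 * C) cu.
rewrite /n_gbsp /Q_haf -/mu; set S := sum_upto 0 K _.
have [S0 SE] : 0 <= S /\ S <= a (multiindex0 N) + c2 * C * sum_upto 1 K u.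
  have T k : within_bound k K ->
      0 <= sum_deg k.*2 (fun J => a J * (mfact J)%:R / haf (repmx B J))
        <= (if k is 0 then a (multiindex0 N) else c2 * C * u k).
    case: k => [_|k kK].
      (* At order 0 the matrix B_J is empty, its hafnian is 1 and the term is a_0. *)
      have m0 : mdeg (multiindex0 N) = 0%N by rewrite /mdeg big1 // => i _; rewrite ffunE.
      rewrite sum_deg0 haf_dim0// divr1 /mfact big1 ?mulr1 ?lexx ?(a0 0%N)//.
      by move=> i _; rewrite ffunE.
    have /andP[-> /le_trans] := sum_deg_div_haf_le _ _ k.+1 _ _ _ isT b0
      (a0 k.+1 ^~ kK) (A0 k.+1 isT kK) (ac2 k.+1 isT kK).
    (* Since -(-1/2 - q2) = 1/2 + q2, the polylogarithm supplies k^q2 and the sqrt k of the central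
       binomial bound; 2 <= C does the rest. *)
    apply; rewrite /= /u -powRN opprB opprK addrC powRD ?pnatr_eq0 ?implybT//.
    rewrite div1r powR12_sqrt// -mulrA -[leRHS]mulrA.
    have -> : c2 * (C * (z ^+ k.+1 * (Num.sqrt k.+1%:R * k.+1%:R `^ q2))) =
        c2 * k.+1%:R `^ q2 * gamma2 ^+ k.+1 *
          (C * Num.sqrt k.+1%:R / (2 * bmin B) ^+ k.+1).
      by rewrite /z expr_div_n; ring.
    rewrite ler_wpM2l ?A0// ler_wpM2r ?invr_ge0 ?exprn_ge0 ?(ltW bb)//.
    by rewrite ler_wpM2r ?sqrtr_ge0.
  split; first by apply: sum_upto_ge0 => k /T /andP[].
  by rewrite -vE; apply: ler_sum_upto.
have mu_gt0 : 0 < mu := lt_trans mu00 mu0mu.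
(* One factor mu of Q cancels and mu^2 turns into the constant -1/(delta eps^2), so only S/mu
   remains to be bounded. *)
have -> : (mu / dfactor lam * S - mu ^+ 2) / (delta * eps ^+ 2 * mu ^+ 2) =
    1 / (dfactor lam * delta * eps ^+ 2) * (S / mu) - 1 / (delta * eps ^+ 2).
  by field; rewrite !gt_eqF.
rewrite lerD2r -[leRHS]mulrA ler_wpM2l//.
  by rewrite divr_ge0 ?mulr_ge0 ?ltW// exprn_ge0// ltW.
rewrite -(mulrA c2) mul1r mulrC -/C.
apply: ler_pM => //; first by rewrite invr_ge0 ltW.
by rewrite lef_pV2 ?posrE// ltW.
Qed.
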